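(* Let $(\mathcal H,T)$ be a pseudogroup of diffeomorphisms on a Hausdorff manifold $T$, and let $H=[\mathcal H]$ be its germ groupoid. Then $H$ is compactly generated (as an object-separated Lie groupoid) if and only if $\mathcal H$ is compactly generated (as a pseudogroup).
   Context: Manifolds are smooth and finite-dimensional, and are not assumed Hausdorff unless explicitly stated. ''Compact'' means that every open cover has a finite subcover (no Hausdorff condition). ''Relatively compact'' in a space means contained in some compact subset of that space. A pseudogroup $(\mathcal H,T)$ on a manifold $T$ is a set $\mathcal H$ of diffeomorphisms between open sets of $T$, containing $\mathrm{id}_T$ and closed under composition (where defined), restriction to open sets, inversion, and gluing (a diffeomorphism between open sets of $T$ whose restrictions to the members of an open cover of its domain lie in $\mathcal H$ lies in $\mathcal H$). The $\mathcal H$-orbit of $x\in T$ is $\{h(x): h\in\mathcal H,\ x\in\mathrm{dom}\,h\}$. For $U\subset T$ open, $\mathcal H_{|U}$ is the pseudogroup on $U$ of elements of $\mathcal H$ with domain and image in $U$. A pseudogroup $(\mathcal H,T)$ is compactly generated if: (i) $T$ admits a relatively compact open subset $U$ meeting every $\mathcal H$-orbit; and (ii) there exist finitely many $h_i\in\mathcal H$ and open sets $U_i\subset U$, each $U_i$ relatively compact in the domain of $h_i$, such that the pseudogroup $\mathcal H_{|U}$ is generated by the restrictions $(h_i)_{|U_i}$. A groupoid $G$ is a small category in which every arrow is invertible, with base (set of objects) $G_0$, source and target maps $s,t:G\to G_0$; it is a Lie groupoid if $G$ and $G_0$ are manifolds, $s,t$ are submersions and the product, inverse and unit maps are smooth.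 It is object-separated if $G_0$ is Hausdorff. The germ groupoid $[\mathcal H]$ of $(\mathcal H,T)$ has base $T$ and arrows the germs $[h]_x: x\to h(x)$ of elements $h\in\mathcal H$ at points $x$ of their domains, with composition of germs $[g]_y[f]_x=[g\circ f]_x$ ($y=f(x)$); its topology has as basic open sets the sets $\{[h]_x: x\in\mathrm{dom}\,h\}$, $h\in\mathcal H$, each identified with $\mathrm{dom}\,h\subset T$ through the source map, which gives the smooth structure. It is a Lie groupoid with $s,t$ local diffeomorphisms. Compact generation of groupoids: for $S\subset G$, $\langle S\rangle$ is the subgroupoid generated by $S$ (the intersection of all subsets of $G$ containing $S$ and closed under composition and inversion), and $S_0=s(S)\cup t(S)$. $S$ generates a full subgroupoid if $\langle S\rangle$ contains every arrow of $G$ with source and target in $S_0$. The $0$-orbit of $x\in G_0$ is $t(s^{-1}(x))$; $S$ is exhaustive if $S_0$ meets every $0$-orbit. An object-separated Lie groupoid $G$ is compactly generated if it contains an open subset which is relatively compact in $G$, exhaustive, and generates a full subgroupoid. *)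

(* Defs.v *)
From HB Require Import structures.
From mathcomp Require Import all_boot all_order all_algebra.
From mathcomp Require Import all_classical all_reals all_analysis.
Set Implicit Arguments.
Unset Strict Implicit.
Unset Printing Implicit Defensive.
Import Order.TTheory GRing.Theory Num.Theory.
Import numFieldNormedType.Exports.
Local Open Scope classical_set_scope.
Local Open Scope ring_scope.

(** Partial maps are functions [A -> option B], so that two partial maps with
    the same domain and the same values on it are equal.  Composition of
    partial maps is ssrfun's [pcomp]. *)

Definition pdom (A B : Type) (f : A -> option B) : set A :=
  [set x | exists y, f x = Some y].

Definition pimg (A B : Type) (f : A -> option B) : set B :=
  [set y | exists x, f x = Some y].

Definition ppreim (A B : Type) (f : A -> option B) (Y : set B) : set A :=
  [set x | exists2 y, f x = Some y & Y y].

Definition prestrict (A B : Type) (f : A -> option B) (X : set A)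
    : A -> option B :=
  fun x => if x \in X then f x else None.

(** [g] is the inverse of the bijection [f] from [pdom f] onto [pimg f]. *)
Definition pinverse (A B : Type) (f : A -> option B) (g : B -> option A) :=
  forall x y, f x = Some y <-> g y = Some x.

(** With [Y := setT] this contains that [pdom f] is open. *)
Definition pcontinuous (A B : topologicalType) (f : A -> option B) :=
  forall Y : set B, open Y -> open (ppreim f Y).

(** [cover_compact] is the open cover property; unlike [compact_cover], which
    needs a pointed space, it applies to an arbitrary, possibly non-Hausdorff
    or empty, space. *)
Definition relatively_compact_in (X : topologicalType) (A B : set X) :=
  exists K : set X, [/\ cover_compact K, A `<=` K & K `<=` B].

(** [f] is of class C^k on the open set [U]: the differential, seen as the
    family of the maps [x |-> 'd f x v], is of class C^(k-1). *)
Fixpoint Ck (R : realType) (n m k : nat) (U : set 'rV[R]_n)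
    (f : 'rV[R]_n -> 'rV[R]_m) : Prop :=
  if k is k'.+1 then
    (forall x, U x -> differentiable f x) /\
    (forall v, Ck k' U (fun x => 'd f x v))
  else forall x, U x -> {for x, continuous f}.

Definition smooth_on (R : realType) (n m : nat) (U : set 'rV[R]_n)
    (f : 'rV[R]_n -> 'rV[R]_m) : Prop :=
  open U /\ forall k, Ck k U f.

Definition esmooth (R : realType) (n m : nat)
    (f : 'rV[R]_n -> option 'rV[R]_m) : Prop :=
  smooth_on (pdom f) (odflt 0 \o f).

(** A homeomorphism from an open subset of [X] onto an open subset of
    R^[cdim]; continuity of [cinv] contains that the latter set is open. *)
Record chart (R : realType) (X : topologicalType) := Chart {
  cdim : nat;
  cmap : X -> option 'rV[R]_cdim;
  cinv : 'rV[R]_cdim -> option X;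
  cmapK : pinverse cmap cinv;
  cmap_continuous : pcontinuous cmap;
  cinv_continuous : pcontinuous cinv }.
Arguments cmap {R X} c.
Arguments cinv {R X} c.

(** A smooth finite-dimensional manifold, given by an atlas.  It is neither
    assumed Hausdorff nor second countable, and the dimension may depend on
    the connected component. *)
Record manifold (R : realType) := Manifold {
  mcarrier :> topologicalType;
  atlas : set (chart R mcarrier);
  atlas_cover : forall x, exists2 c, atlas c & pdom (cmap c) x;
  atlas_compat : forall c d, atlas c -> atlas d ->
    esmooth (pcomp (cmap d) (cinv c)) }.
Arguments atlas {R} m.

Definition in_charts (R : realType) (M N : manifold R) (f : M -> option N)
    (c : chart R M) (d : chart R N) : 'rV[R]_(cdim c) -> option 'rV[R]_(cdim d) :=
  pcomp (cmap d) (pcomp f (cinv c)).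
Arguments in_charts {R M N} f c d.

Definition psmooth (R : realType) (M N : manifold R) (f : M -> option N) :=
  pcontinuous f /\
  forall c d, atlas M c -> atlas N d -> esmooth (in_charts f c d).

Definition smooth (R : realType) (M N : manifold R) (f : M -> N) :=
  psmooth (fun x => Some (f x) : option N).

Definition submersion (R : realType) (M N : manifold R) (f : M -> N) :=
  smooth f /\
  forall c d, atlas M c -> atlas N d ->
    let F := in_charts (fun x => Some (f x) : option N) c d in
    forall v, pdom F v -> forall w, exists u, 'd (odflt 0 \o F) v u = w.

(** A diffeomorphism from the open set [pdom f] onto the open set [pimg f]. *)
Definition local_diffeo (R : realType) (M N : manifold R) (f : M -> option N) :=
  exists g : N -> option M, [/\ pinverse f g, psmooth f & psmooth g].

(** [P] is a pseudogroup on the open submanifold [U] of [T], whose elements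
    are represented as partial maps of [T] with domain and image in [U]. *)
Record is_pseudogroup_on (R : realType) (T : manifold R) (U : set T)
    (P : set (T -> option T)) : Prop := IsPseudogroupOn {
  pg_diffeo : forall h, P h -> local_diffeo h;
  pg_dom : forall h, P h -> pdom h `<=` U;
  pg_img : forall h, P h -> pimg h `<=` U;
  pg_id : P (prestrict Some U);
  pg_comp : forall g h, P g -> P h -> P (pcomp g h);
  pg_restrict : forall h V, P h -> open V -> P (prestrict h V);
  pg_inv : forall h g, P h -> pinverse h g -> P g;
  pg_glue : forall h (C : set (set T)), local_diffeo h ->
    (forall V, C V -> open V) -> \bigcup_(V in C) V = pdom h ->
    (forall V, C V -> P (prestrict h V)) -> P h }.

Record pseudogroup (R : realType) (T : manifold R) := Pseudogroup {
  pgset : set (T -> option T);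
  pgP : is_pseudogroup_on setT pgset }.

Definition pg_orbit (R : realType) (T : manifold R) (H : pseudogroup T) (x : T)
    : set T :=
  [set y | exists2 h, pgset H h & h x = Some y].

Definition pg_sub (R : realType) (T : manifold R) (H : pseudogroup T)
    (U : set T) : set (T -> option T) :=
  [set h | [/\ pgset H h, pdom h `<=` U & pimg h `<=` U]].

Definition pg_compactly_generated (R : realType) (T : manifold R)
    (H : pseudogroup T) : Prop :=
  exists U : set T,
    [/\ open U, relatively_compact_in U setT,
        forall x, U `&` pg_orbit H x !=set0 &
        exists (n : nat) (h : 'I_n -> T -> option T) (V : 'I_n -> set T),
          (forall i, [/\ pgset H (h i), open (V i), V i `<=` U &
                         relatively_compact_in (V i) (pdom (h i))]) /\
          pg_sub H U = smallest (is_pseudogroup_on U)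
                                [set prestrict (h i) (V i) | i in setT]].

(** A small category with objects [B] and arrows [A], all invertible;
    [gcomp g f e] is the arrow [g f] from [gsrc f] to [gtgt g]. *)
Record groupoid (B A : Type) := Groupoid {
  gsrc : A -> B;
  gtgt : A -> B;
  gunit : B -> A;
  gcomp : forall g f : A, gsrc g = gtgt f -> A;
  ginv : A -> A;
  gsrc_unit : forall x, gsrc (gunit x) = x;
  gtgt_unit : forall x, gtgt (gunit x) = x;
  gsrc_comp : forall g f e, gsrc (@gcomp g f e) = gsrc f;
  gtgt_comp : forall g f e, gtgt (@gcomp g f e) = gtgt g;
  gsrc_inv : forall f, gsrc (ginv f) = gtgt f;
  gtgt_inv : forall f, gtgt (ginv f) = gsrc f;
  gcompA : forall h g f e1 e2 e3 e4,
    @gcomp (@gcomp h g e1) f e3 = @gcomp h (@gcomp g f e2) e4;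
  gcomp1g : forall f e, @gcomp (gunit (gtgt f)) f e = f;
  gcompg1 : forall f e, @gcomp f (gunit (gsrc f)) e = f;
  gcompVg : forall f e, @gcomp (ginv f) f e = gunit (gsrc f);
  gcompgV : forall f e, @gcomp f (ginv f) e = gunit (gtgt f) }.

(** Smoothness of the product on the fibred product
    [{(g, f) | gsrc g = gtgt f}]: since [gsrc] and [gtgt] are submersions this
    is an embedded submanifold of the product, and a map on it is smooth iff,
    in charts, it extends locally to a smooth map of the ambient space. *)
Definition smooth_comp (R : realType) (B A : manifold R) (G : groupoid B A) :=
  forall (g f : A) (e : gsrc G g = gtgt G f) (c d k : chart R A)
      (v : 'rV[R]_(cdim c)) (w : 'rV[R]_(cdim d)),
    atlas A c -> atlas A d -> atlas A k ->
    cmap c g = Some v -> cmap d f = Some w -> pdom (cmap k) (gcomp e) ->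
    exists (W : set 'rV[R]_(cdim c + cdim d))
           (F : 'rV[R]_(cdim c + cdim d) -> 'rV[R]_(cdim k)),
      [/\ smooth_on W F, W (row_mx v w) &
          forall g' f' (e' : gsrc G g' = gtgt G f') v' w',
            cmap c g' = Some v' -> cmap d f' = Some w' -> W (row_mx v' w') ->
            cmap k (gcomp e') = Some (F (row_mx v' w'))].

Record lie_groupoid (R : realType) := LieGroupoid {
  lobj : manifold R;
  larr : manifold R;
  lgpd :> groupoid lobj larr;
  lsrc_submersion : submersion (gsrc lgpd : larr -> lobj);
  ltgt_submersion : submersion (gtgt lgpd : larr -> lobj);
  lunit_smooth : smooth (gunit lgpd : lobj -> larr);
  linv_smooth : smooth (ginv lgpd : larr -> larr);
  lcomp_smooth : smooth_comp lgpd }.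

Definition object_separated (R : realType) (G : lie_groupoid R) :=
  hausdorff_space (lobj G).

Section CompactGeneration.
Variables (R : realType) (G : lie_groupoid R).
Implicit Type S : set (larr G).

Definition gpd_closed S : Prop :=
  (forall (g f : larr G) (e : gsrc G g = gtgt G f),
     S g -> S f -> S (gcomp e)) /\
  (forall g, S g -> S (ginv G g)).

Definition gpd_generated S : set (larr G) := smallest gpd_closed S.

Definition gpd_base S : set (lobj G) := gsrc G @` S `|` gtgt G @` S.

Definition generates_full S : Prop :=
  forall g, gpd_base S (gsrc G g) -> gpd_base S (gtgt G g) ->
    gpd_generated S g.

Definition gpd_orbit (x : lobj G) : set (lobj G) :=
  gtgt G @` (gsrc G @^-1` [set x]).

Definition exhaustive S : Prop :=
  forall x, gpd_base S `&` gpd_orbit x !=set0.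

Definition gpd_compactly_generated : Prop :=
  object_separated G /\
  exists S, [/\ open S, relatively_compact_in S setT,
                exhaustive S & generates_full S].

End CompactGeneration.

Section Calculus.
Variable R : realType.

Lemma diff_near_eq n m (f g : 'rV[R]_n -> 'rV[R]_m) x :
  (\forall y \near x, f y = g y) -> differentiable f x ->
  differentiable g x /\ 'd g x = 'd f x :> (_ -> _).
Proof.
move=> fg df.
have fgx : f x = g x := nbhs_singleton fg.
have fg0 : \forall h \near (0 : 'rV[R]_n), f (h + x) = g (h + x).
  by move: fg; rewrite (near_shift (0 : 'rV[R]_n)) subr0.
have E : g \o shift x = cst (g x) + 'd f x +o_ 0 id.
  apply/eqaddoP => _/posnumP[eps].
  have /eqaddoP/(_ _ (gt0 eps)) := diff_locally df.
  apply: filterS2 fg0 => h /= e1.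
  by rewrite /shift/= !fctE /= e1 fgx.
have dE : 'd g x = 'd f x :> (_ -> _).
  by apply: diff_unique; [exact: (diff_continuous df)|exact: E].
have dg : differentiable g x.
  apply/diff_locallyP; split; rewrite dE; last exact: E.
  exact: (diff_continuous df).
exact: (conj dg dE).
Qed.

Lemma Ck_eq n m k (U : set 'rV[R]_n) (f g : 'rV[R]_n -> 'rV[R]_m) :
  open U -> (forall x, U x -> f x = g x) -> Ck k U f -> Ck k U g.
Proof.
move=> oU; elim: k f g => [|k IH] f g fg /=.
  move=> cf x Ux A; rewrite -(fg _ Ux) => /(cf x Ux).
  apply: filterS2 (open_nbhs_nbhs (conj oU Ux)) => y /fg /= e.
  by rewrite /= -e.
have N x : U x -> \forall y \near x, f y = g y.
  by move=> Ux; apply: filterS (open_nbhs_nbhs (conj oU Ux)) => y /fg.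
move=> [df dC]; split.
  by move=> x Ux; have [] := diff_near_eq (N x Ux) (df x Ux).
move=> v; apply: IH (dC v) => x Ux.
have [_ e] := diff_near_eq (N x Ux) (df x Ux).
exact: (congr1 (fun F : _ -> _ => F v) (esym e)).
Qed.

Lemma Ck_sub n m k (U V : set 'rV[R]_n) (f : 'rV[R]_n -> 'rV[R]_m) :
  V `<=` U -> Ck k U f -> Ck k V f.
Proof.
move=> VU; elim: k f => [|k IH] f /=; first by move=> cf x /VU; apply: cf.
by move=> [df dC]; split=> [x /VU|v]; [apply: df|apply: IH].
Qed.

Lemma Ck_rsubmx n1 n2 m k (U : set 'rV[R]_n2) (f : 'rV[R]_n2 -> 'rV[R]_m) :
  open U -> Ck k U f ->
  Ck k [set w : 'rV[R]_(n1 + n2) | U (rsubmx w)] (f \o rsubmx).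
Proof.
move=> oU.
have oV : open [set w : 'rV[R]_(n1 + n2) | U (rsubmx w)].
  by apply: (open_comp _ oU) => w _; exact: continuous_rsubmx.
elim: k f => [|k IH] f /=.
  move=> cf x Ux; apply: continuous_comp; first exact: continuous_rsubmx.
  exact: cf.
move=> [df dC]; split=> [x Ux|v].
  by apply: differentiable_comp; [exact: differentiable_rsubmx|exact: df].
apply: Ck_eq (IH _ (dC (rsubmx v))) => // x Ux.
rewrite diff_comp /=; [|exact: differentiable_rsubmx|exact: df].
by rewrite diff_lin//; exact: continuous_rsubmx.
Qed.

Lemma esmooth_sub n m (f g : 'rV[R]_n -> option 'rV[R]_m) :
  open (pdom g) -> (forall x y, g x = Some y -> f x = Some y) ->
  esmooth f -> esmooth g.
Proof.
move=> og gf [of_ sf]; split=> // k.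
apply: (@Ck_eq _ _ _ _ (odflt 0 \o f)) => //.
  by move=> x [y gy] /=; rewrite gy (gf _ _ gy).
by apply: Ck_sub (sf k) => x [y /gf]; exists y.
Qed.

Lemma diff_surj n m (f g : 'rV[R]_n -> option 'rV[R]_m)
    (f' : 'rV[R]_m -> option 'rV[R]_n) v :
  esmooth f -> esmooth f' -> pinverse f f' -> 
  open (pdom g) -> (forall x y, g x = Some y -> f x = Some y) ->
  pdom g v -> forall w, exists u, 'd (odflt 0 \o g) v u = w.
Proof.
move=> [of_ sf] [of'_ sf'] ff' og gf gv w.
have [y gvy] := gv; have fvy := gf _ _ gvy.
have f'y : f' y = Some v by apply/ff'.
have dfv : differentiable (odflt 0 \o f) v.
  by have /= [+ _] := sf 1%N; apply; exists y.
have df'y : differentiable (odflt 0 \o f') y.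
  by have /= [+ _] := sf' 1%N; apply; exists v.
have [_ ->] : differentiable (odflt 0 \o g) v /\
    'd (odflt 0 \o g) v = 'd (odflt 0 \o f) v :> (_ -> _).
  apply: diff_near_eq dfv; apply: filterS (open_nbhs_nbhs (conj og gv)).
  by move=> x [z gz] /=; rewrite gz (gf _ _ gz).
have ev : v = (odflt 0 \o f') y by rewrite /= f'y.
rewrite ev in dfv.
exists ('d (odflt 0 \o f') y w); rewrite [in LHS]ev.
rewrite -[LHS]/(('d (odflt 0 \o f) ((odflt 0 \o f') y)
  \o 'd (odflt 0 \o f') y) w).
rewrite -diff_comp//.
have [_ e] : differentiable ((odflt 0 \o f) \o (odflt 0 \o f')) y /\
    'd ((odflt 0 \o f) \o (odflt 0 \o f')) y = 'd id y :> (_ -> _).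
  apply: diff_near_eq => //.
  have yd : pdom f' y by exists v.
  apply: filterS (open_nbhs_nbhs (conj of'_ yd)) => z [x f'z] /=.
  by rewrite f'z /=; have /ff' -> := f'z.
rewrite e.
have -> : 'd id y = id :> ('rV[R]_m -> 'rV[R]_m) by exact: diff_val.
by [].
Qed.

End Calculus.

Section PartialMaps.

Lemma pcompP (A B C : Type) (g : B -> option C) (f : A -> option B) x z :
  pcomp g f x = Some z <-> exists2 y, f x = Some y & g y = Some z.
Proof.
rewrite /pcomp; case: (f x) => [y|] /=; split => //.
- by exists y.
- by move=> [_ [<-]].
- by move=> [].
Qed.

Lemma prestrictP (A B : Type) (f : A -> option B) X x y :
  prestrict f X x = Some y <-> X x /\ f x = Some y.
Proof.
rewrite /prestrict; case: ifPn => [/set_mem Xx|]; first by split => [|[]].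
by move=> /negP nX; split => // -[/mem_set].
Qed.

Lemma pcompA (A B C D : Type) (h : C -> option D) (g : B -> option C)
  (f : A -> option B) : pcomp (pcomp h g) f = pcomp h (pcomp g f).
Proof. by apply/funext => x; rewrite /pcomp; case: (f x). Qed.

Lemma pinverse_sym (A B : Type) (f : A -> option B) g :
  pinverse f g -> pinverse g f.
Proof. by move=> fg x y; rewrite fg. Qed.

Lemma open_pdom (A B : topologicalType) (f : A -> option B) :
  pcontinuous f -> open (pdom f).
Proof.
move=> cf; suff -> : pdom f = ppreim f setT by exact/cf/openT.
by apply/seteqP; split=> [x [y e]|x [y e _]]; exists y.
Qed.

Lemma pcontinuous_comp (A B C : topologicalType) (g : B -> option C)
    (f : A -> option B) :
  pcontinuous g -> pcontinuous f -> pcontinuous (pcomp g f).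
Proof.
move=> cg cf Y oY.
suff -> : ppreim (pcomp g f) Y = ppreim f (ppreim g Y) by exact/cf/cg.
apply/seteqP; split=> x.
- by move=> [z /pcompP[y fy gz] Yz]; exists y => //; exists z.
- by move=> [y fy [z gz Yz]]; exists z => //; apply/pcompP; exists y.
Qed.

Lemma pcontinuous_nbhs (A B : topologicalType) (f : A -> option B) x y
    (Y : set B) :
  pcontinuous f -> f x = Some y -> nbhs y Y -> nbhs x (ppreim f Y).
Proof.
move=> cf fxy; rewrite !nbhsE => -[Z [oZ Zy] ZY].
exists (ppreim f Z); first by split; [exact: cf|exists y].
by move=> u [v fv /ZY Yv]; exists v.
Qed.

Lemma pcomp_near (A B : topologicalType) (C : Type) (a a' : A -> option B)
    (b b' : B -> option C) x y :
  pcontinuous a -> a x = Some y -> (\forall u \near x, a u = a' u) ->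
  (\forall v \near y, b v = b' v) ->
  \forall u \near x, pcomp b a u = pcomp b' a' u.
Proof.
move=> ca axy aa' /(pcontinuous_nbhs ca axy); apply: filterS2 aa' => u.
by rewrite /pcomp => <- [v -> /=].
Qed.

Lemma pinverse_near (A B : topologicalType) (h h' : A -> option B)
    (g g' : B -> option A) x y :
  pcontinuous g -> h x = Some y -> pinverse h g -> pinverse h' g' ->
  (\forall u \near x, h u = h' u) -> \forall v \near y, g v = g' v.
Proof.
move=> cg hxy hg h'g' /(pcontinuous_nbhs cg ((hg _ _).1 hxy)).
apply: filterS => v [u gv e]; rewrite gv; apply/esym/h'g'.
by rewrite -e; apply/hg.
Qed.

End PartialMaps.

Section ChartInverse.
Variables (R : realType) (X : topologicalType) (c : chart R X).

Lemma cmap_cinv x v : cmap c x = Some v -> cinv c v = Some x.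
Proof. exact: (cmapK _ _).1. Qed.

Lemma cinv_cmap x v : cinv c v = Some x -> cmap c x = Some v.
Proof. exact: (cmapK _ _).2. Qed.

End ChartInverse.

Section GermDef.
Variables (R : realType) (T : manifold R) (H : pseudogroup T).
Implicit Types (h k : T -> option T) (x y : T).

(** The equivalence class [[h]_x], for [h] in [H]. *)
Definition germ_class h x : set (T -> option T) :=
  [set k | pgset H k /\ \forall y \near x, k y = h y].

(** An arrow [[h]_x : x -> h x]; the target is determined by the other two
    fields. *)
Record germ := Germ {
  germ_src : T;
  germ_tgt : T;
  germ_set : set (T -> option T);
  germP : exists h, [/\ pgset H h, h germ_src = Some germ_tgt &
                        germ_set = germ_class h germ_src] }.

Definition germ_at h x y (hH : pgset H h) (hxy : h x = Some y) : germ :=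
  @Germ x y (germ_class h x)
    (ex_intro _ h (And3 hH hxy (erefl (germ_class h x)))).

(** The basic open set [{[h]_x | x \in pdom h}]: a germ is equal to [[h]_x]
    iff its source is [x] and the class it consists of contains [h]. *)
Definition bisection h : set germ := [set g | germ_set g h].

Let hcont h : pgset H h -> pcontinuous h.
Proof. by move=> /(pg_diffeo (pgP H))[g [_ []]]. Qed.

Let hinv h : pgset H h -> exists2 g, pgset H g & pinverse h g.
Proof.
move=> hH; have [g [hg _ _]] := pg_diffeo (pgP H) hH.
by exists g => //; exact: (pg_inv (pgP H) hH hg).
Qed.

Lemma germ_classE h k x : germ_class h x k -> germ_class k x = germ_class h x.
Proof.
move=> [kH kh]; apply/seteqP; split=> l [lH lk]; split=> //.
  by apply: filterS2 lk kh => y -> .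
by apply: filterS2 lk kh => y -> ->.
Qed.

Lemma germ_class_refl h x : pgset H h -> germ_class h x h.
Proof. by move=> hH; split=> //; apply: filterE. Qed.

Lemma germ_setP (g : germ) k : germ_set g k ->
  [/\ pgset H k, k (germ_src g) = Some (germ_tgt g) &
      germ_set g = germ_class k (germ_src g)].
Proof.
case: g => x y A /= [h [hH hxy ->]] kh; rewrite (germ_classE kh).
by have [kH n] := kh; split=> //; rewrite (nbhs_singleton n).
Qed.

Lemma germ_rep (g : germ) : exists h, germ_set g h.
Proof.
by case: g => x y A /= [h [hH _ ->]]; exists h; exact: germ_class_refl.
Qed.

Lemma germ_ext (g g' : germ) k : germ_set g k -> germ_set g' k ->
  germ_src g = germ_src g' -> g = g'.
Proof.
move=> /germ_setP[_] + + /germ_setP[_].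
case: g => x y A P; case: g' => x' y' A' P' /= kx AE ky' AE' xx'.
move: P P'; rewrite AE AE' -xx' => P P'.
have yy' : y = y' by move: kx ky'; rewrite -xx' => -> [].
by move: P P'; rewrite -yy' => P P'; congr Germ; exact: Prop_irrelevance.
Qed.

Lemma germ_set_near (g : germ) h k : germ_set g h -> pgset H k ->
  (\forall y \near germ_src g, k y = h y) -> germ_set g k.
Proof. by move=> /germ_setP[_ _ ->] kH kh; split. Qed.

Lemma germ_set_sub (g : germ) h k : germ_set g h -> pgset H k ->
  (forall y z, k y = Some z -> h y = Some z) -> pdom k (germ_src g) ->
  germ_set g k.
Proof.
move=> gh kH kh kd; apply: (germ_set_near gh kH).
apply: filterS (open_nbhs_nbhs (conj (open_pdom (hcont kH)) kd)) => y [z kz].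
by rewrite kz (kh _ _ kz).
Qed.

Lemma germ_set_sup (g : germ) h k : germ_set g h -> pgset H k ->
  (forall y z, h y = Some z -> k y = Some z) -> germ_set g k.
Proof.
move=> gh kH hk; have [hH hs _] := germ_setP gh.
apply: (germ_set_near gh kH).
have hd : pdom h (germ_src g) by exists (germ_tgt g).
apply: filterS (open_nbhs_nbhs (conj (open_pdom (hcont hH)) hd)) => y [z hz].
by rewrite hz (hk _ _ hz).
Qed.

Lemma germ_set_restrict (g : germ) h (V : set T) : open V ->
  germ_set g (prestrict h V) /\ pgset H h <-> germ_set g h /\ V (germ_src g).
Proof.
move=> oV; split=> [[gV hH]|[gh Vg]].
- have [rH rs _] := germ_setP gV; split; last by have /prestrictP[] := rs.
  by apply: germ_set_sup gV hH _ => y z /prestrictP[].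
- have [rH rs _] := germ_setP gh; split=> //; have rH' : pgset H (prestrict h V) by apply: (pg_restrict (pgP H)).
  apply: (germ_set_sub gh rH') => [y z /prestrictP[]//|].
  by exists (germ_tgt g); apply/prestrictP.
Qed.

HB.instance Definition _ := gen_eqMixin germ.
HB.instance Definition _ := gen_choiceMixin germ.

(** The topology with the bisections as basic open sets. *)
Definition germ_open (A : set germ) : Prop :=
  forall g, A g -> exists2 h, bisection h g & bisection h `<=` A.

Lemma germ_openT : germ_open setT.
Proof. by move=> g _; have [h gh] := germ_rep g; exists h. Qed.

Lemma germ_openI : setI_closed germ_open.
Proof.
move=> A B oA oB g [Ag Bg].
have [h gh hA] := oA _ Ag; have [k gk kB] := oB _ Bg.
have [hH _ hE] := germ_setP gh; have [kH _ _] := germ_setP gk.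
have : germ_set g k := gk; rewrite hE => -[_ n].
have {n} : nbhs (germ_src g) [set y | k y = h y] := n.
rewrite nbhsE => -[V [oV Vg] Vkh].
exists (prestrict h V).
  by have [] := (germ_set_restrict g h oV).2 (conj gh Vg).
move=> g' g'h; have [g'h' Vg'] := (germ_set_restrict g' h oV).1 (conj g'h hH).
split; first exact: hA.
apply/kB/(germ_set_near g'h' kH).
by apply: filterS (open_nbhs_nbhs (conj oV Vg')).
Qed.

Lemma germ_open_bigcup (I : Type) (f : I -> set germ) :
  (forall i, germ_open (f i)) -> germ_open (\bigcup_i f i).
Proof.
move=> of_ g [i _ /of_[h gh hf]]; exists h => //.
by apply: subset_trans hf _ => g' fg'; exists i.
Qed.

HB.instance Definition _ :=
  isOpenTopological.Build germ germ_openT germ_openI germ_open_bigcup.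

Lemma open_germ (A : set germ) : open A <-> germ_open A.
Proof. by []. Qed.

Lemma open_bisection h (V : set T) : open V ->
  open (bisection h `&` germ_src @^-1` V).
Proof.
move=> oV; apply/open_germ => g [gh Vg].
have [hH _ _] := germ_setP gh.
exists (prestrict h V); first by have [] := (germ_set_restrict g h oV).2 (conj gh Vg).
by move=> g' g'h; exact: (germ_set_restrict g' h oV).1 (conj g'h hH).
Qed.

Arguments open_bisection h {V} _.

Lemma open_germ_src (A : set germ) : open A -> open (germ_src @` A).
Proof.
move=> /open_germ oA; rewrite openE => _ [g Ag <-].
have [h gh hA] := oA _ Ag; have [hH hs _] := germ_setP gh.
have hd : pdom h (germ_src g) by exists (germ_tgt g).
apply: filterS (open_nbhs_nbhs (conj (open_pdom (hcont hH)) hd)) => x [y hxy].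
by exists (germ_at hH hxy) => //; apply: hA; exact: germ_class_refl.
Qed.

(** [x |-> [h]_x], the inverse of the source map on [bisection h]. *)
Definition germ_section h (hH : pgset H h) x : option germ :=
  match h x as o return h x = o -> option germ with
  | Some y => fun e => Some (germ_at hH e)
  | None => fun _ => None
  end erefl.

Lemma germ_sectionP h (hH : pgset H h) x g :
  germ_section hH x = Some g <-> bisection h g /\ germ_src g = x.
Proof.
rewrite /germ_section; move: (erefl (h x)).
case: {2 3}(h x) => [y|] e; split=> //.
- by move=> [<-]; split=> //; exact: germ_class_refl.
- move=> [gh gx]; congr Some; apply: (@germ_ext _ _ h) => //.
  exact: germ_class_refl.
- by move=> [/germ_setP[_ + _] gx]; rewrite gx e.
Qed.

Section GermChart.
Variables (h : T -> option T) (hH : pgset H h) (c : chart R T).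

Definition germ_cmap (g : germ) : option 'rV[R]_(cdim c) :=
  if g \in bisection h then cmap c (germ_src g) else None.

Definition germ_cinv : 'rV[R]_(cdim c) -> option germ :=
  pcomp (germ_section hH) (cinv c).

Lemma germ_cmapP g v :
  germ_cmap g = Some v <-> bisection h g /\ cmap c (germ_src g) = Some v.
Proof.
rewrite /germ_cmap; case: ifPn => [/set_mem gh|]; first by split=> [|[]].
by move=> /negP n; split=> // -[/mem_set].
Qed.

Lemma germ_cinvP v g :
  germ_cinv v = Some g <-> bisection h g /\ cinv c v = Some (germ_src g).
Proof.
split=> [/pcompP[x cx /germ_sectionP[gh gx]]|[gh cg]].
  by rewrite gx.
by apply/pcompP; exists (germ_src g) => //; apply/germ_sectionP.
Qed.

Lemma germ_cmapK : pinverse germ_cmap germ_cinv.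
Proof.
move=> g v; split=> [/germ_cmapP[gh e]|/germ_cinvP[gh e]].
  by apply/germ_cinvP; split=> //; exact: cmap_cinv.
by apply/germ_cmapP; split=> //; exact: cinv_cmap.
Qed.

Lemma germ_cmap_continuous : pcontinuous germ_cmap.
Proof.
move=> Y oY; have := open_bisection h (@cmap_continuous _ _ c _ oY).
congr open; apply/seteqP; split=> g.
- by move=> [gh [v gv Yv]]; exists v => //; apply/germ_cmapP.
- by move=> [v /germ_cmapP[gh gv] Yv]; split=> //; exists v.
Qed.

Lemma germ_cinv_continuous : pcontinuous germ_cinv.
Proof.
move=> Y oY.
have oYh : open (Y `&` bisection h).
  apply: openI => //; have := open_bisection h openT.
  by rewrite preimage_setT setIT.
have := @cinv_continuous _ _ c _ (open_germ_src oYh).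
congr open; apply/seteqP; split=> v.
- by move=> [x cx [g [Yg gh] gx]]; exists g => //; apply/germ_cinvP; rewrite gx.
- by move=> [g /germ_cinvP[gh gv] Yg]; exists (germ_src g) => //; exists g.
Qed.

Definition germ_chart : chart R germ :=
  Chart germ_cmapK germ_cmap_continuous germ_cinv_continuous.

End GermChart.

(** The charts of [T], read on the bisections through the source map. *)
Definition germ_atlas : set (chart R germ) :=
  [set C | exists h (hH : pgset H h) c, atlas T c /\ C = germ_chart hH c].

Lemma germ_atlas_cover g : exists2 C, germ_atlas C & pdom (cmap C) g.
Proof.
have [h gh] := germ_rep g; have [hH _ _] := germ_setP gh.
have [c ac [v cv]] := atlas_cover (germ_src g).
exists (germ_chart hH c); first by exists h, hH, c.
by exists v; apply/germ_cmapP.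
Qed.

Lemma germ_atlas_compat C D : germ_atlas C -> germ_atlas D ->
  esmooth (pcomp (cmap D) (cinv C)).
Proof.
move=> [h [hH [c [ac ->]]]] [k [kH [d [ad ->]]]].
apply: esmooth_sub (atlas_compat ac ad).
  apply: open_pdom; apply: pcontinuous_comp.
    exact: germ_cmap_continuous.
  exact: germ_cinv_continuous.
move=> v w /pcompP[g /germ_cinvP[_ cv] /germ_cmapP[_ dv]].
by apply/pcompP; exists (germ_src g).
Qed.

Definition germ_manifold : manifold R :=
  Manifold germ_atlas_cover germ_atlas_compat.

Definition germ_unit (x : T) : germ :=
  @germ_at (prestrict Some setT) x x (pg_id (pgP H))
    ((prestrictP _ _ _ _).2 (conj I (erefl (Some x)))).

Lemma germ_comp_proof (g f : germ) : germ_src g = germ_tgt f ->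
  exists h, [/\ pgset H h, h (germ_src f) = Some (germ_tgt g) &
    [set k | pgset H k /\ exists b a, [/\ germ_set g b, germ_set f a &
       \forall y \near germ_src f, k y = pcomp b a y]]
    = germ_class h (germ_src f)].
Proof.
move=> e; have [b gb] := germ_rep g; have [a fa] := germ_rep f.
have [bH bs bE] := germ_setP gb; have [aH as_ aE] := germ_setP fa.
exists (pcomp b a); split.
- exact: (pg_comp (pgP H)).
- by apply/pcompP; exists (germ_tgt f) => //; rewrite -e.
apply/seteqP; split=> k [kH].
- move=> [b' [a' [gb' fa' kba]]]; split=> //.
  have [a'H a's _] := germ_setP fa'.
  move: gb' fa'; rewrite bE aE => -[_ bb'] [_ aa'].
  rewrite e in bb'.
  have := pcomp_near (hcont a'H) a's aa' bb'.
  by apply: filterS2 kba => y -> ->.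
- by move=> kba; split=> //; exists b, a.
Qed.

(** [[b]_y [a]_x = [b \o a]_x] for [y = a x]. *)
Definition germ_comp (g f : germ) (e : germ_src g = germ_tgt f) : germ :=
  Germ (germ_comp_proof e).

Lemma germ_inv_proof (f : germ) :
  exists h, [/\ pgset H h, h (germ_tgt f) = Some (germ_src f) &
    [set k | pgset H k /\ exists a b, [/\ germ_set f a, pinverse a b &
       \forall y \near germ_tgt f, k y = b y]]
    = germ_class h (germ_tgt f)].
Proof.
have [a fa] := germ_rep f; have [aH as_ aE] := germ_setP fa.
have [b bH ab] := hinv aH; exists b; split=> //; first exact/ab.
apply/seteqP; split=> k [kH].
- move=> [a' [b' [fa' ab' kb]]]; split=> //.
  have [a'H a's _] := germ_setP fa'.
  move: fa'; rewrite aE => -[_ aa'].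
  have b'H : pgset H b' by exact: (pg_inv (pgP H) a'H).
  have := pinverse_near (hcont b'H) a's ab' ab aa'.
  by apply: filterS2 kb => y -> ->.
- by move=> kb; split=> //; exists a, b.
Qed.

Definition germ_inv (f : germ) : germ := Germ (germ_inv_proof f).

Lemma germ_set_unit x : germ_set (germ_unit x) (prestrict Some setT).
Proof. exact/germ_class_refl/(pg_id (pgP H)). Qed.

Lemma germ_set_comp g f (e : germ_src g = germ_tgt f) b a :
  germ_set g b -> germ_set f a -> germ_set (germ_comp e) (pcomp b a).
Proof.
move=> gb fa; have [bH _ _] := germ_setP gb; have [aH _ _] := germ_setP fa.
split; first exact: (pg_comp (pgP H)).
by exists b, a; split=> //; apply: filterE.
Qed.

Lemma germ_set_inv f a b :
  germ_set f a -> pinverse a b -> germ_set (germ_inv f) b.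
Proof.
move=> fa ab; have [aH _ _] := germ_setP fa.
split; first exact: (pg_inv (pgP H) aH).
by exists a, b; split=> //; apply: filterE.
Qed.

Lemma germ_compA (h g f : germ) e1 e2 e3 e4 :
  @germ_comp (@germ_comp h g e1) f e3 = @germ_comp h (@germ_comp g f e2) e4.
Proof.
have [c hc] := germ_rep h; have [b gb] := germ_rep g.
have [a fa] := germ_rep f.
have m := germ_set_comp e3 (germ_set_comp e1 hc gb) fa.
apply: germ_ext m _ _ => //; rewrite pcompA.
exact: germ_set_comp (germ_set_comp e2 gb fa).
Qed.

Lemma pcomp1p (a : T -> option T) : pcomp (prestrict Some setT) a = a.
Proof.
apply/funext => x; rewrite /pcomp; case: (a x) => //= y.
exact/prestrictP.
Qed.

Lemma pcompp1 (a : T -> option T) : pcomp a (prestrict Some setT) = a.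
Proof.
apply/funext => x; rewrite /pcomp.
by have -> : prestrict Some setT x = Some x by exact/prestrictP.
Qed.

Lemma germ_comp1g f e : @germ_comp (germ_unit (germ_tgt f)) f e = f.
Proof.
have [a fa] := germ_rep f; apply: (germ_ext _ fa) => //.
rewrite -[X in germ_set _ X]pcomp1p.
exact: germ_set_comp (germ_set_unit _) fa.
Qed.

Lemma germ_compg1 f e : @germ_comp f (germ_unit (germ_src f)) e = f.
Proof.
have [a fa] := germ_rep f; apply: (germ_ext _ fa) => //.
rewrite -[X in germ_set _ X]pcompp1.
exact: germ_set_comp fa (germ_set_unit _).
Qed.

Lemma germ_compVg f e : @germ_comp (germ_inv f) f e = germ_unit (germ_src f).
Proof.
have [a fa] := germ_rep f; have [aH as_ _] := germ_setP fa.
have [b bH ab] := hinv aH.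
have m := germ_set_comp e (germ_set_inv fa ab) fa.
apply: germ_ext _ (germ_set_unit _) _ => //.
apply: (germ_set_sup m (pg_id (pgP H))) => y z /pcompP[u au bu].
by apply/prestrictP; split=> //; rewrite -bu; apply/esym/ab.
Qed.

Lemma germ_compgV f e : @germ_comp f (germ_inv f) e = germ_unit (germ_tgt f).
Proof.
have [a fa] := germ_rep f; have [aH as_ _] := germ_setP fa.
have [b bH ab] := hinv aH.
have m := germ_set_comp e fa (germ_set_inv fa ab).
apply: germ_ext _ (germ_set_unit _) _ => //.
apply: (germ_set_sup m (pg_id (pgP H))) => y z /pcompP[u bu au].
by apply/prestrictP; split=> //; rewrite -au; apply/esym/ab.
Qed.

Definition germ_gpd : groupoid T germ :=
  @Groupoid T germ germ_src germ_tgt germ_unit germ_comp germ_inv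
    (fun=> erefl) (fun=> erefl) (fun _ _ _ => erefl) (fun _ _ _ => erefl)
    (fun=> erefl) (fun=> erefl)
    germ_compA germ_comp1g germ_compg1 germ_compVg germ_compgV.

Lemma pcontinuous_src : pcontinuous (fun g => Some (germ_src g)).
Proof.
move=> Y oY; apply/open_germ => g [_ [<-] Yg].
have [h gh] := germ_rep g.
have [k gk kY] := (open_germ _).1 (open_bisection h oY) _ (conj gh Yg).
by exists k => // g' /kY[_ ?]; exists (germ_src g').
Qed.

Lemma pcontinuous_tgt : pcontinuous (fun g => Some (germ_tgt g)).
Proof.
move=> Y oY; apply/open_germ => g [_ [<-] Yg].
have [h gh] := germ_rep g; have [hH hs _] := germ_setP gh.
have oV := hcont hH oY.
have Vg : ppreim h Y (germ_src g) by exists (germ_tgt g).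
have [k gk kY] := (open_germ _).1 (open_bisection h oV) _ (conj gh Vg).
exists k => // g' /kY[/germ_setP[_ + _] [y hy Yy]].
by rewrite hy => -[yE]; exists y => //; rewrite yE.
Qed.

Lemma pcontinuous_unit : pcontinuous (fun x => Some (germ_unit x)).
Proof.
move=> Y /open_germ oY; rewrite openE => x [_ [<-] Yx].
have [k xk kY] := oY _ Yx; have [_ k1] := xk.
rewrite /interior; apply: filterS (nbhs_interior k1) => y k1y.
exists (germ_unit y) => //; apply: kY; have [kH _ _] := germ_setP xk.
exact: (germ_set_near (germ_set_unit y) kH).
Qed.

Lemma germ_invK f : germ_inv (germ_inv f) = f.
Proof.
have [a fa] := germ_rep f; have [aH _ _] := germ_setP fa.
have [b bH ab] := hinv aH.
apply: (germ_ext _ fa) => //; apply: germ_set_inv (pinverse_sym ab).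
exact: germ_set_inv fa ab.
Qed.

Lemma pcontinuous_inv : pcontinuous (fun g => Some (germ_inv g)).
Proof.
move=> Y /open_germ oY; apply/open_germ => g [_ [<-] Yg].
have [k gk kY] := oY _ Yg; have [kH _ _] := germ_setP gk.
have [k' k'H kk'] := hinv kH.
exists k'; first by rewrite -(germ_invK g); exact: germ_set_inv gk kk'.
move=> g' g'k'; exists (germ_inv g') => //; apply: kY.
exact: germ_set_inv g'k' (pinverse_sym kk').
Qed.

Lemma germ_src_submersion : @submersion R germ_manifold T germ_src.
Proof.
have key C d : germ_atlas C -> atlas T d ->
    let F := @in_charts R germ_manifold T (fun g => Some (germ_src g)) C d in
    esmooth F /\ forall v, pdom F v -> forall w, exists u,
      'd (odflt 0 \o F) v u = w.
  move=> [h [hH [c [ac ->]]]] ad F.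
  have oF : open (pdom F).
    apply: open_pdom; apply: pcontinuous_comp; first exact: cmap_continuous.
    apply: pcontinuous_comp; first exact: pcontinuous_src.
    exact: germ_cinv_continuous.
  have Fs v w : F v = Some w -> pcomp (cmap d) (cinv c) v = Some w.
    move=> /pcompP[x /pcompP[g /germ_cinvP[_ cg] [<-]] dg].
    by apply/pcompP; exists (germ_src g).
  split; first exact: esmooth_sub (atlas_compat ac ad).
  move=> v Fv; apply: diff_surj (atlas_compat ac ad) (atlas_compat ad ac) _ oF Fs Fv.
  move=> a b; split=> /pcompP[x xa xb]; apply/pcompP; exists x;
    by [exact: cmap_cinv|exact: cinv_cmap].
split; last by move=> C d aC ad F; exact: (key C d aC ad).2.
by split; [exact: pcontinuous_src|move=> C d aC ad; have [] := key C d aC ad].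
Qed.

Lemma germ_tgt_submersion : @submersion R germ_manifold T germ_tgt.
Proof.
have key C d : germ_atlas C -> atlas T d ->
    let F := @in_charts R germ_manifold T (fun g => Some (germ_tgt g)) C d in
    esmooth F /\ forall v, pdom F v -> forall w, exists u,
      'd (odflt 0 \o F) v u = w.
  move=> [h [hH [c [ac ->]]]] ad F.
  have oF : open (pdom F).
    apply: open_pdom; apply: pcontinuous_comp; first exact: cmap_continuous.
    apply: pcontinuous_comp; first exact: pcontinuous_tgt.
    exact: germ_cinv_continuous.
  have Fs v w : F v = Some w -> in_charts h c d v = Some w.
    move=> /pcompP[x /pcompP[g /germ_cinvP[gh cg] [<-]] dg].
    have [_ hs _] := germ_setP gh.
    apply/pcompP; exists (germ_tgt g) => //; apply/pcompP.
    by exists (germ_src g).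
  have [h' [hh' [_ sh] [_ sh']]] := pg_diffeo (pgP H) hH.
  split; first exact: esmooth_sub (sh c d ac ad).
  move=> v Fv; apply: diff_surj (sh c d ac ad) (sh' d c ad ac) _ oF Fs Fv.
  move=> a b; split=> /pcompP[x /pcompP[y ya yx] xb]; apply/pcompP; exists y.
  - by apply/pcompP; exists x; [exact: cmap_cinv|exact/hh'].
  - exact: cinv_cmap.
  - by apply/pcompP; exists x; [exact: cmap_cinv|exact/hh'].
  - exact: cinv_cmap.
split; last by move=> C d aC ad F; exact: (key C d aC ad).2.
by split; [exact: pcontinuous_tgt|move=> C d aC ad; have [] := key C d aC ad].
Qed.

Lemma germ_unit_smooth : @smooth R T germ_manifold germ_unit.
Proof.
split; first exact: pcontinuous_unit.
move=> d C ad [h [hH [c [ac ->]]]]; apply: esmooth_sub (atlas_compat ad ac).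
  apply: open_pdom; apply: pcontinuous_comp.
    exact: germ_cmap_continuous.
  apply: pcontinuous_comp; first exact: pcontinuous_unit.
  exact: cinv_continuous.
move=> v w /pcompP[_ /pcompP[x dx [<-]] /germ_cmapP[_ cx]].
by apply/pcompP; exists x.
Qed.

Lemma germ_inv_smooth : @smooth R germ_manifold germ_manifold germ_inv.
Proof.
split; first exact: pcontinuous_inv.
move=> C D [h [hH [c [ac ->]]]] [k [kH [d [ad ->]]]].
have [h' [_ [_ sh] _]] := pg_diffeo (pgP H) hH.
apply: esmooth_sub (sh c d ac ad).
  apply: open_pdom; apply: pcontinuous_comp.
    exact: germ_cmap_continuous.
  apply: pcontinuous_comp; first exact: pcontinuous_inv.
  exact: germ_cinv_continuous.
move=> v w /pcompP[_ /pcompP[g /germ_cinvP[gh cg] [<-]] /germ_cmapP[_ dg]].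
have [_ hs _] := germ_setP gh.
apply/pcompP; exists (germ_tgt g) => //; apply/pcompP.
by exists (germ_src g).
Qed.

Lemma germ_comp_smooth : @smooth_comp R T germ_manifold germ_gpd.
Proof.
move=> g f e C D K v w aC aD aK; move: aC aD aK v w.
move=> [b [bH [c [ac ->]]]] [a [aH [d [ad ->]]]] [l [lH [k [ak ->]]]] v w.
move=> /germ_cmapP[gb gv] /germ_cmapP[fa fw] [z /germ_cmapP[el ez]].
have baH : pgset H (pcomp b a) by exact: (pg_comp (pgP H)).
pose X : set germ := bisection (pcomp b a) `&` bisection l.
have oX : open X.
  apply: openI; [have := open_bisection (pcomp b a) openT|
                 have := open_bisection l openT];
  by rewrite preimage_setT setIT.
pose V := germ_src @` X.
have oV : open V by exact: open_germ_src.
pose t := pcomp (cmap k) (cinv d).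
have st : esmooth t := atlas_compat ad ak.
pose U : set 'rV[R]_(cdim d) := ppreim (cinv d) V `&` pdom t.
have oU : open U by apply: openI; [exact: cinv_continuous|case: st].
exists [set w | U (rsubmx w)], ((odflt 0 \o t) \o rsubmx); split.
- split.
    by apply: (open_comp _ oU) => x _; exact: continuous_rsubmx.
  move=> m; apply: Ck_rsubmx => //.
  by apply: Ck_sub (st.2 m) => x [].
- rewrite /= row_mxKr; split; last first.
    by exists z; apply/pcompP; exists (germ_src f) => //; exact: cmap_cinv.
  exists (germ_src f); first exact: cmap_cinv.
  by exists (germ_comp e) => //; split=> //; exact: germ_set_comp.
move=> g' f' e' v' w' /germ_cmapP[g'b _] /germ_cmapP[f'a f'w'].
rewrite /= row_mxKr => -[[x dx [u [ub ul] ux]] [y ty]]; rewrite ty /=.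
have f'd : cinv d w' = Some (germ_src f') by exact: cmap_cinv.
have xf : x = germ_src f' by move: dx; rewrite f'd => -[].
apply/germ_cmapP; split.
  suff <- : u = germ_comp e' by [].
  by apply: (germ_ext ub); [exact: germ_set_comp|rewrite ux].
by move: ty => /pcompP[x']; rewrite f'd => -[<-].
Qed.

Definition germ_groupoid : lie_groupoid R :=
  @LieGroupoid R T germ_manifold germ_gpd
    germ_src_submersion germ_tgt_submersion
    germ_unit_smooth germ_inv_smooth germ_comp_smooth.

End GermDef.

(* Main.v *)
Require Import Defs.
From HB Require Import structures.
From mathcomp Require Import all_boot all_order all_algebra.
From mathcomp Require Import finmap.
From mathcomp Require Import all_classical all_reals all_analysis.
Set Implicit Arguments.
Unset Strict Implicit.
Unset Printing Implicit Defensive.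
Import Order.TTheory GRing.Theory Num.Theory.
Import numFieldNormedType.Exports.
Local Open Scope classical_set_scope.
Local Open Scope ring_scope.

(** Both notions of compact generation provide an open set [U] of [T], and
    both say that a finite amount of compact data generates everything above
    [U]: maps in one case, germs in the other.  The link is the correspondence
    between pseudogroups and subgroupoids of the germ groupoid: a subgroupoid
    containing the units over [U] determines the pseudogroup on [U] of the
    maps all of whose germs belong to it ([is_pseudogroup_gpd_closed]), the
    germs of a pseudogroup form a subgroupoid ([gpd_closed_germs]), and, by
    gluing, a pseudogroup is recovered from its germs ([pseudogroup_germs]).

    If the restrictions of the [h_i] to the [V_i] generate the pseudogroup
    induced on [U], let [S] consist of the units over [U] and of the germs of
    the [h_i] at the points of the [V_i].  It is open, relatively compact as a
    finite union of images of relatively compact sets under sections of the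
    source map, and has base [U].  The elements of the induced pseudogroup
    whose germs are all generated by [S] form a pseudogroup containing the
    generators, hence all of them do, which is fullness.

    Conversely, let [S] be an open set of germs as in the definition, and [U]
    its base.  Since [T] is locally compact ([manifold_locally_compact]), a
    compact set containing [S] is covered by finitely many bisections of maps
    [h_i] over open sets relatively compact in the domain of [h_i].  Let [V_i]
    be the set of sources of the elements of [S] lying in the [i]-th
    bisection; then [S] is the union of the bisections of the restrictions of
    the [h_i] to the [V_i].  The germs of the elements
    of a pseudogroup on [U] containing these restrictions include the
    subgroupoid generated by [S], hence all the arrows between points of [U];
    by gluing this pseudogroup contains the one induced on [U]. *)

(** * Compactness in terms of open covers *)

Lemma cover_compact0 (X : topologicalType) : cover_compact (@set0 X).
Proof. by move=> I D f _ _; exists fset0 => // i; rewrite inE. Qed.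

Lemma cover_compactU (X : topologicalType) (A B : set X) :
  cover_compact A -> cover_compact B -> cover_compact (A `|` B).
Proof.
move=> cA cB I D f of_ ABf.
have [D1 D1D AD1] := cA I D f of_ (fun x Ax => ABf x (or_introl Ax)).
have [D2 D2D BD2] := cB I D f of_ (fun x Bx => ABf x (or_intror Bx)).
exists (D1 `|` D2)%fset.
  by move=> i; rewrite inE => /orP[/D1D|/D2D].
move=> x [/AD1|/BD2] [i /= iD fix_]; exists i => //=;
  by rewrite inE iD ?orbT.
Qed.

Lemma cover_compact_bigcup (X : topologicalType) (I : finType)
    (K : I -> set X) :
  (forall i, cover_compact (K i)) -> cover_compact (\bigcup_i K i).
Proof.
move=> cK; have -> : \bigcup_i K i = \big[setU/set0]_(i <- enum I) K i.
  rewrite -bigcup_seq; congr bigcup; apply/seteqP.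
  by split=> // i _ /=; rewrite mem_enum.
by apply: big_ind => //; [exact: cover_compact0|exact: cover_compactU].
Qed.

Lemma cover_compact_pimage (X Y : topologicalType) (f : X -> option Y)
    (K : set X) :
  pcontinuous f -> K `<=` pdom f -> cover_compact K ->
  cover_compact [set y | exists2 x, K x & f x = Some y].
Proof.
move=> cf Kf cK I D F oF KF.
have [i Di|x Kx|D' D'D KD'] := cK I D (fun i => ppreim f (F i)).
- exact/cf/oF.
- have [y fxy] := Kf _ Kx; have [|i Di Fiy] := KF y; first by exists x.
  by exists i => //; exists y.
exists D' => // y [x /KD'[i D'i [z fxz Fiz]]]; rewrite fxz => -[<-].
by exists i.
Qed.

Lemma cover_compact_image (X Y : topologicalType) (f : X -> Y) (K : set X) :
  pcontinuous (fun x => Some (f x)) -> cover_compact K ->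
  cover_compact (f @` K).
Proof.
move=> cf cK.
have -> : f @` K = [set y | exists2 x, K x & Some (f x) = Some y].
  by apply/seteqP; split=> y [x Kx]; [move=> <-|move=> [<-]]; exists x.
by apply: cover_compact_pimage => // x _; exists (f x).
Qed.

Lemma nbhs_cover_compact_rV (R : realType) (n : nat) (v : 'rV[R]_n)
    (A : set 'rV[R]_n) :
  nbhs v A -> exists B, [/\ cover_compact B, nbhs v B & B `<=` A].
Proof.
move=> /nbhs_closedballP[r rA]; exists (closed_ball v r%:num); split=> //.
- rewrite -compact_cover; apply: bounded_closed_compact.
    rewrite closed_ballE// /closed_ball_; exists (`|v| + r%:num).
    split=> [|M ltM w /= vw]; first exact: num_real.
    rewrite (le_trans _ (ltW ltM))// -[w](subKr v).
    by rewrite (le_trans (ler_normB _ _))// lerD2l.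
  exact: closed_ball_closed.
- by apply/nbhs_closedballP; exists r.
Qed.

(** Manifolds are locally compact, in the sense that compact neighbourhoods
    form a basis: a closed ball in a chart is transported to the manifold. *)
Lemma manifold_locally_compact (R : realType) (T : manifold R) (x : T)
    (D : set T) : open D -> D x ->
  exists V, [/\ open V, V x & relatively_compact_in V D].
Proof.
move=> oD Dx; have [c ac [v cxv]] := atlas_cover x.
have cvx := cmap_cinv cxv.
have [|B [cB vB BD]] := @nbhs_cover_compact_rV R _ v (ppreim (cinv c) D).
  apply: open_nbhs_nbhs; split; first exact: cinv_continuous.
  by exists x.
have := pcontinuous_nbhs (@cmap_continuous _ _ c) cxv vB.
rewrite nbhsE => -[V [oV Vx] VB]; exists V; split=> //.
exists [set y | exists2 u, B u & cinv c u = Some y]; split.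
- apply: cover_compact_pimage => //; first exact: cinv_continuous.
  by move=> u /BD[y cuy _]; exists y.
- by move=> y /VB[u cyu Bu]; exists u => //; exact: cmap_cinv.
- by move=> y [u /BD[z cuz Dz]]; rewrite cuz => -[<-].
Qed.

(** * Pseudogroups and subgroupoids of the germ groupoid *)

Section Germs.
Variables (R : realType) (T : manifold R) (H : pseudogroup T).
Local Notation germ := (@germ R T H).
Implicit Types (U : set T) (P : set (T -> option T)) (A : set germ).

Lemma pg_pcontinuous h : pgset H h -> pcontinuous h.
Proof. by move=> /(pg_diffeo (pgP H))[g [_ []]]. Qed.

Lemma open_bisectionT h : open (bisection h : set germ).
Proof.
by have := @open_bisection R T H h _ openT; rewrite preimage_setT setIT.
Qed.

Lemma bisection_section h x : pgset H h -> pdom h x ->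
  exists2 g : germ, bisection h g & germ_src g = x.
Proof.
move=> hH [y hxy]; exists (germ_at hH hxy) => //.
exact: germ_class_refl.
Qed.

Lemma pcontinuous_section h (hH : pgset H h) : pcontinuous (germ_section hH).
Proof.
move=> Y oY.
have -> : ppreim (germ_section hH) Y = @germ_src R T H @` (Y `&` bisection h).
  apply/seteqP; split=> x.
    by move=> [g /germ_sectionP[gh <-] Yg]; exists g.
  by move=> [g [Yg gh] <-]; exists g => //; apply/germ_sectionP.
by apply/open_germ_src/openI => //; exact: open_bisectionT.
Qed.

(** The bisection of [h] over a compact subset of its domain is compact. *)
Lemma relatively_compact_bisection h (V : set T) :
  pgset H h -> open V -> relatively_compact_in V (pdom h) ->
  relatively_compact_in (bisection (prestrict h V) : set germ) setT.
Proof.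
move=> hH oV [K [cK VK Kh]].
exists [set g | exists2 x, K x & germ_section hH x = Some g]; split=> //.
- apply: cover_compact_pimage => //; first exact: pcontinuous_section.
  move=> x /Kh /(bisection_section hH)[g gh gx].
  by exists g; apply/germ_sectionP.
- move=> g gV; have [gh Vg] := (germ_set_restrict g h oV).1 (conj gV hH).
  by exists (germ_src g); [exact: VK|apply/germ_sectionP].
Qed.

(** An arrow between points of [U] is the germ of a map between open subsets
    of [U]. *)
Lemma pg_sub_germ U (g : germ) : open U -> U (germ_src g) -> U (germ_tgt g) ->
  exists2 h, pg_sub H U h & germ_set g h.
Proof.
move=> oU Us Ut; have [h gh] := germ_rep g; have [hH hs _] := germ_setP gh.
have oW : open (U `&` ppreim h U) by apply: openI => //; exact: pg_pcontinuous.
exists (prestrict h (U `&` ppreim h U)).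
  split; first exact: (pg_restrict (pgP H)).
  - by move=> x [y /prestrictP[[]]].
  - by move=> y [x /prestrictP[[_ [z hz Uz]]]]; rewrite hz => -[<-].
have Wg : (U `&` ppreim h U) (germ_src g) by split=> //; exists (germ_tgt g).
exact: ((germ_set_restrict g h oW).2 (conj gh Wg)).1.
Qed.

Lemma is_pseudogroup_pg_sub U : open U -> is_pseudogroup_on U (pg_sub H U).
Proof.
move=> oU; split.
- by move=> h [hH _ _]; exact: (pg_diffeo (pgP H)).
- by move=> h [].
- by move=> h [].
- split.
  + have := pg_restrict (pgP H) (pg_id (pgP H)) oU.
    congr (pgset H _); apply/funext => x; rewrite /prestrict.
    by rewrite in_setT.
  + by move=> x [y /prestrictP[]].
  + by move=> y [x /prestrictP[Ux [<-]]].
- move=> g h [gH _ gU] [hH hU _]; split; first exact: (pg_comp (pgP H)).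
  + by move=> x [z /pcompP[y hxy _]]; apply: hU; exists y.
  + by move=> z [x /pcompP[y _ gyz]]; apply: gU; exists y.
- move=> h V [hH hU hU'] oV; split; first exact: (pg_restrict (pgP H)).
  + by move=> x [y /prestrictP[_ hxy]]; apply: hU; exists y.
  + by move=> y [x /prestrictP[_ hxy]]; apply: hU'; exists x.
- move=> h g [hH hU hU'] hg; split; first exact: (pg_inv (pgP H) hH hg).
  + by move=> y [x /hg hxy]; apply: hU'; exists x.
  + by move=> x [y /hg hxy]; apply: hU; exists y.
- move=> h C dh oC Ch CP; split.
  + by apply: (pg_glue (pgP H) dh oC Ch) => V /CP[].
  + move=> x [y hxy]; have : pdom h x by exists y.
    rewrite -Ch => -[V CV Vx]; have [_ + _] := CP V CV; apply.
    by exists y; apply/prestrictP.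
  + move=> y [x hxy]; have : pdom h x by exists y.
    rewrite -Ch => -[V CV Vx]; have [_ _] := CP V CV; apply.
    by exists x; apply/prestrictP.
Qed.

(** Any subgroupoid [A] of the germ groupoid containing the units over [U]
    defines a pseudogroup on [U]: the maps all of whose germs are in [A]. *)
Lemma is_pseudogroup_gpd_closed U A : open U ->
  @gpd_closed R (germ_groupoid H) A -> bisection (prestrict Some U) `<=` A ->
  is_pseudogroup_on U [set h | pg_sub H U h /\ bisection h `<=` A].
Proof.
move=> oU [Acomp Ainv] AU; have pU := is_pseudogroup_pg_sub oU; split.
- by move=> h [hU _]; exact: (pg_diffeo pU).
- by move=> h [[]].
- by move=> h [[]].
- by split => //; exact: (pg_id pU).
- move=> b a [bU bA] [aU aA]; split; first exact: (pg_comp pU).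
  have [[bH _ _] [aH _ _]] := (bU, aU).
  move=> g gba; have [_ /pcompP[y axy byz] _] := germ_setP gba.
  have aE := germ_class_refl (germ_src g) aH.
  have bE := germ_class_refl y bH.
  pose gb : germ := germ_at bH byz; pose ga : germ := germ_at aH axy.
  have e : germ_src gb = germ_tgt ga by [].
  have -> : g = germ_comp e.
    exact: (germ_ext gba (germ_set_comp e (bE : germ_set gb b) aE)).
  by apply: (Acomp gb ga e); [exact: bA|exact: aA].
- move=> h V [hU hA] oV; split; first exact: (pg_restrict pU).
  move=> g ghV; apply: hA; have [hH _ _] := hU.
  exact: ((germ_set_restrict g h oV).1 (conj ghV hH)).1.
- move=> h k [hU hA] hk; split; first exact: (pg_inv pU hU hk).
  move=> g gk; rewrite -(germ_invK g); apply: (Ainv (germ_inv g)).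
  exact/hA/(germ_set_inv gk)/pinverse_sym.
- move=> h C dh oC Ch CP; split.
    by apply: (pg_glue pU dh oC Ch) => V /CP[].
  move=> g gh; have [_ hs _] := germ_setP gh.
  have : pdom h (germ_src g) by exists (germ_tgt g).
  rewrite -Ch => -[V CV Vg]; apply: (CP V CV).2.
  exact: ((germ_set_restrict g h (oC V CV)).2 (conj gh Vg)).1.
Qed.

(** Conversely the germs of the elements of a pseudogroup form a
    subgroupoid. *)
Lemma gpd_closed_germs U P : is_pseudogroup_on U P ->
  @gpd_closed R (germ_groupoid H) [set g | exists2 h, P h & germ_set g h].
Proof.
move=> pP; split=> [g f e [b Pb gb] [a Pa fa]|g [a Pa ga]].
  by exists (pcomp b a); [exact: (pg_comp pP)|exact: germ_set_comp].
have [b [ab _ _]] := pg_diffeo pP Pa.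
by exists b; [exact: (pg_inv pP Pa ab)|exact: germ_set_inv ga ab].
Qed.

(** By gluing, a pseudogroup contains every map of [H] that coincides with one
    of its elements near each point. *)
Lemma pseudogroup_germs U P h : is_pseudogroup_on U P -> pgset H h ->
  (bisection h : set germ) `<=` [set g | exists2 k, P k & germ_set g k] -> P h.
Proof.
move=> pP hH hP.
(* The cover on which to glue: all the open sets where [h] restricts to an
   element of [P]. *)
pose C : set (set T) :=
  [set V | [/\ open V, V `<=` pdom h & P (prestrict h V)]].
apply: (pg_glue (C := C) pP).
- exact: (pg_diffeo (pgP H)).
- by move=> V [].
- apply/seteqP; split=> [x [V [_ Vh _]]|x hx]; first exact: Vh.
  have [g gh gx] := bisection_section hH hx.
  have [k Pk gk] := hP g gh; have [_ _ gE] := germ_setP gk.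
  have : germ_set g h by [].
  rewrite gE => -[_]; rewrite gx => n.
  have {n} : nbhs x (pdom h `&` [set y | h y = k y]).
    apply: filterI => //; apply: open_nbhs_nbhs; split=> //.
    exact/open_pdom/pg_pcontinuous.
  rewrite nbhsE => -[V [oV Vx] Vhk]; exists V => //; split=> //.
    by move=> y /Vhk[].
  suff -> : prestrict h V = prestrict k V by exact: (pg_restrict pP).
  apply/funext => y; rewrite /prestrict; case: ifPn => // /set_mem Vy.
  by have [_ ->] := Vhk y Vy.
- by move=> V [].
Qed.

Lemma gpd_orbit_germ x : @gpd_orbit R (germ_groupoid H) x = pg_orbit H x.
Proof.
apply/seteqP; split=> y.
  move=> [g gx <-]; have [h gh] := germ_rep g; have [hH hs _] := germ_setP gh.
  by exists h => //; rewrite -hs; congr h; exact: (esym gx).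
by move=> [h hH hxy]; exists (germ_at hH hxy).
Qed.

End Germs.

Lemma gpd_closed_generated (R : realType) (G : lie_groupoid R)
    (S : set (larr G)) : gpd_closed (gpd_generated S).
Proof.
split=> [g f e Sg Sf|g Sg] A [cA SA].
  by apply: cA.1; [exact: Sg|exact: Sf].
by apply: cA.2; exact: Sg.
Qed.

(** * The two implications *)

Lemma germ_groupoid_compactly_generated (R : realType) (T : manifold R)
    (H : pseudogroup T) (hT : hausdorff_space T) :
  pg_compactly_generated H -> gpd_compactly_generated (germ_groupoid H).
Proof.
move=> [U [oU [K [cK UK _]] Uorb [n [h [V [hV HU]]]]]]; split=> //.
pose S : set (germ H) := bisection (prestrict Some U) `|`
  \bigcup_i bisection (prestrict (h i) (V i)).
have pU := is_pseudogroup_pg_sub H oU.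
have hVU i : pg_sub H U (prestrict (h i) (V i)).
  by rewrite HU; apply: sub_gen_smallest; exists i.
have idS x : U x -> exists2 g, S g & germ_src g = x.
  move=> Ux; have [idH _ _] := pg_id pU.
  have [|g gU gx] := bisection_section (x := x) idH.
    by exists x; apply/prestrictP.
  by exists g => //; left.
have baseU : @gpd_base R (germ_groupoid H) S = U.
  have SU g : S g -> exists2 k, pg_sub H U k & germ_set g k.
    case=> [gU|[i _ gi]].
      by exists (prestrict Some U) => //; exact: (pg_id pU).
    by exists (prestrict (h i) (V i)).
  apply/seteqP; split=> [x|x /idS[g Sg gx]]; last by left; exists g.
  case=> -[g /SU[k [_ kU kU'] /germ_setP[_ ks _]] <-].
    by apply: kU; exists (germ_tgt g).
  by apply: kU'; exists (germ_src g).
exists S; split.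
- apply: openU; first exact: open_bisectionT.
  by apply: bigcup_open => i _; exact: open_bisectionT.
- have : forall i, exists L, cover_compact L /\
      (bisection (prestrict (h i) (V i)) : set (germ H)) `<=` L.
    move=> i; have [hH oV _ cV] := hV i.
    have [L [cL hL _]] := relatively_compact_bisection hH oV cV.
    by exists L.
  move=> /choice[L /all_and2[cL hL]].
  exists (@germ_unit R T H @` K `|` \bigcup_i L i); split=> //.
    apply: cover_compactU; last exact: cover_compact_bigcup.
    by apply: cover_compact_image => //; exact: pcontinuous_unit.
  move=> g [gU|[i _ /hL gi]]; [left|by right; exists i].
  have [_ /prestrictP[Ug _] _] := germ_setP gU.
  exists (germ_src g); first exact: UK.
  apply: (germ_ext (k := prestrict Some setT)) => //.
    exact: germ_set_unit.
  apply: (germ_set_sup gU); first exact: (pg_id (pgP H)).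
  by move=> y z /prestrictP[_ ?]; apply/prestrictP.
- by move=> x; rewrite baseU gpd_orbit_germ.
- move=> g; rewrite baseU => Us Ut.
  have [k kU gk] := pg_sub_germ oU Us Ut.
  (* Minimality of the generated pseudogroup, against the one that the
     subgroupoid generated by [S] defines. *)
  move: kU; rewrite HU => kU.
  suff [_] : [set k | pg_sub H U k /\ bisection k `<=`
      @gpd_generated R (germ_groupoid H) S] k by exact.
  move: k kU {gk}; apply: smallest_sub.
    apply: is_pseudogroup_gpd_closed => //; first exact: gpd_closed_generated.
    by move=> f fU; apply: sub_gen_smallest; left.
  move=> _ [i _ <-]; split; first exact: hVU.
  by move=> f fi; apply: sub_gen_smallest; right; exists i.
Qed.

Lemma pg_compactly_generated_germ (R : realType) (T : manifold R)
    (H : pseudogroup T) :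
  gpd_compactly_generated (germ_groupoid H) -> pg_compactly_generated H.
Proof.
move=> [_ [S [oS [K [cK SK _]] Sexh Sfull]]].
set U := gpd_base S in Sexh.
have oU : open U.
  (* The targets of the elements of [S] are the sources of their inverses. *)
  have -> : U = @germ_src R T H @` S `|`
      @germ_src R T H @` ppreim (fun g => Some (germ_inv g)) S.
    congr (_ `|` _); apply/seteqP; split=> x.
      move=> [g Sg <-]; exists (germ_inv g) => //.
      by exists g => //; rewrite germ_invK.
    by move=> [g [_ [<-] Sg] <-]; exists (germ_inv g).
  apply: openU; apply: open_germ_src => //.
  exact: pcontinuous_inv.
have pU := is_pseudogroup_pg_sub H oU.
have : forall g : germ H, exists hW : (T -> option T) * set T,
    [/\ germ_set g hW.1, open hW.2, hW.2 (germ_src g) &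
        relatively_compact_in hW.2 (pdom hW.1)].
  move=> g; have [h gh] := germ_rep g; have [hH hs _] := germ_setP gh.
  have [||W [oW Wg cW]] := @manifold_locally_compact R T (germ_src g) (pdom h).
  - exact: (open_pdom (pg_pcontinuous hH)).
  - by exists (germ_tgt g).
  by exists (h, W).
move=> /choice[hW hWP].
pose B (g : germ H) : set (germ H) :=
  bisection (hW g).1 `&` @germ_src R T H @^-1` (hW g).2.
have [g _|g _|D _ KD] := cK (germ H) setT B.
- by have [_ ? _ _] := hWP g; exact: open_bisection.
- by exists g => //; have [? _ ? _] := hWP g.
pose d i := tnth (in_tuple (enum_fset D)) i.
pose h i := (hW (d i)).1; pose V i := @germ_src R T H @` (S `&` B (d i)).
have hH i : pgset H (h i) by have [/germ_setP[]] := hWP (d i).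
have oV i : open (V i).
  apply: open_germ_src; apply: openI => //.
  by have [_ ? _ _] := hWP (d i); exact: open_bisection.
(* [h i] sends [V i] into [U] because its germs there are in [S]; [S] is the
   union of these bisections. *)
have hVS i : (bisection (prestrict (h i) (V i)) : set (germ H)) `<=` S.
  move=> g gV; have [gh [f [Sf [fh _]] fg]] :=
    (germ_set_restrict g (h i) (oV i)).1 (conj gV (hH i)).
  by rewrite (germ_ext gh fh (esym fg)).
have ShV : S `<=` \bigcup_i bisection (prestrict (h i) (V i)).
  move=> g Sg; have [f fD Bf] := KD _ (SK _ Sg).
  have /tnthP[i fi] : f \in in_tuple (enum_fset D) by [].
  have [gh Vg] : germ_set g (h i) /\ V i (germ_src g).
    by rewrite /h /V /d -fi; split; [case: Bf|exists g].
  by exists i => //; exact: ((germ_set_restrict g _ (oV i)).2 (conj gh Vg)).1.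
exists U; split=> //.
- exists (@germ_src R T H @` K `|` @germ_tgt R T H @` K); split=> //.
    apply: cover_compactU; apply: cover_compact_image => //.
      exact: pcontinuous_src.
    exact: pcontinuous_tgt.
  by move=> x [] [g /SK Kg <-]; [left|right]; exists g.
- by move=> x; rewrite -gpd_orbit_germ; exact: Sexh.
exists _, h, V; split=> [i|].
  split=> //; first by move=> _ [g [Sg _] <-]; left; exists g.
  have [_ _ _ [L [cL WL Lh]]] := hWP (d i); exists L; split=> //.
  by move=> _ [g [_ [_ /WL Lg]] <-].
apply/seteqP; split.
- move=> k [kH kU kU'] P [pP hP].
  apply: (pseudogroup_germs pP kH) => g gk; have [_ ks _] := germ_setP gk.
  apply: (Sfull g).
  + by apply: kU; exists (germ_tgt g).
  + by apply: kU'; exists (germ_src g).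
  + split; first exact: gpd_closed_germs pP.
    move=> f /ShV[i _ fi]; exists (prestrict (h i) (V i)) => //.
    by apply: hP; exists i.
- apply: smallest_sub => // _ [i _ <-].
  have hVH : pgset H (prestrict (h i) (V i)) by exact: (pg_restrict (pgP H)).
  split=> // [x hx|y [x hxy]].
    have [g gh gx] := bisection_section hVH hx.
    by left; exists g => //; exact: hVS gh.
  have [|g gh gx] := bisection_section (x := x) hVH; first by exists y.
  have [_ + _] := germ_setP gh; rewrite gx hxy => -[->].
  by right; exists g => //; exact: hVS gh.
Qed.

Theorem proposition3p8 (R : realType) (T : manifold R) (H : pseudogroup T)
    (hT : hausdorff_space T) :
  gpd_compactly_generated (germ_groupoid H) <-> pg_compactly_generated H.
Proof.
split; first exact: pg_compactly_generated_germ.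
exact: germ_groupoid_compactly_generated.
Qed.
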